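(* Let $X$ and $Y$ be compact Hausdorff spaces and let $X=\bigcup_{i\in I}R_i$ and $Y=\bigcup_{j\in J}S_j$ be decompositions. Then a decomposition of the join $X\star Y$ is given by $$X\star Y=\bigcup\nolimits_{i,j}R_i\sqcup\bigl(R_i\times S_j\times(0,1)\bigr)\sqcup S_j,$$ that is, the sets $R_i$ ($i\in I$), $S_j$ ($j\in J$) and $R_i\times S_j\times(0,1)$ ($(i,j)\in I\times J$), viewed as subsets of $X\star Y$, are the pieces of a decomposition of $X\star Y$.
   Context: An $I$-decomposition of a topological space $X$ ($I$ a set) is a locally finite collection of disjoint locally closed subsets $S_i\subset X$, one for each $i\in I$ (called pieces), such that $X=\bigcup_{i\in I}S_i$ and $S_i\cap\overline{S}_j\neq\emptyset$ implies $S_i\subset\overline{S}_j$. Locally finite means that every point has a neighborhood intersecting only finitely many pieces; locally closed means being the intersection of an open and a closed subset. The join $X\star Y$ is the quotient of $X\times Y\times[0,1]$ by the equivalence relation generated by $(x_0,y_1,0)\sim(x_0,y_2,0)$ and $(x_1,y_0,1)\sim(x_2,y_0,1)$ for all $x_0,x_1,x_2\in X$ and $y_0,y_1,y_2\in Y$. Let $\pi:X\times Y\times[0,1]\to X\star Y$ be the quotient map. As a set, $X\star Y$ is identified with $X\sqcup(X\times Y\times(0,1))\sqcup Y$, so that $R_i$ stands for $\pi(R_i\times Y\times\{0\})$, $S_j$ for $\pi(X\times S_j\times\{1\})$, and $R_i\times S_j\times(0,1)$ for $\pi(R_i\times S_j\times(0,1))$. *)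

(* Defs.v *)
From HB Require Import structures.
From Stdlib Require Import Relation_Operators.
From mathcomp Require Import all_boot all_order all_algebra generic_quotient.
From mathcomp Require Import all_classical all_reals topology normedtype.

Set Implicit Arguments.
Unset Strict Implicit.
Unset Printing Implicit Defensive.

Import Order.TTheory GRing.Theory Num.Theory.
Import numFieldTopology.Exports.

Local Open Scope classical_set_scope.
Local Open Scope ring_scope.
Local Open Scope quotient_scope.

Definition locally_closed (T : topologicalType) (A : set T) : Prop :=
  exists O C : set T, [/\ open O, closed C & A = O `&` C].

(* Finiteness is counted on indices; for a pairwise disjoint family this is
   finiteness of the set of pieces that meet U. *)
Definition locally_finite (T : topologicalType) (I : Type) (S : I -> set T)
    : Prop :=
  forall x : T, exists2 U : set T, nbhs x U &
    finite_set [set i | U `&` S i !=set0].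

(* Pieces are allowed to be empty. *)
Record decomposition (T : topologicalType) (I : Type) (S : I -> set T)
    : Prop := Decomposition {
  decomposition_locally_finite : locally_finite S ;
  decomposition_disjoint : trivIset setT S ;
  decomposition_locally_closed : forall i, locally_closed (S i) ;
  decomposition_cover : \bigcup_i S i = setT ;
  decomposition_frontier : forall i j,
    S i `&` closure (S j) !=set0 -> S i `<=` closure (S j)
}.

Definition unit_itv (R : realType) : Type := set_type `[(0 : R), 1]%classic.

HB.instance Definition _ (R : realType) :=
  Topological.copy (unit_itv R) (set_type `[(0 : R), 1]%classic).

Definition join_cyl (R : realType) (X Y : topologicalType) : Type :=
  (X * Y * unit_itv R)%type.

HB.instance Definition _ (R : realType) (X Y : topologicalType) :=
  Topological.copy (join_cyl R X Y) (X * Y * unit_itv R)%type.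

Inductive join_step (R : realType) (X Y : topologicalType) :
    join_cyl R X Y -> join_cyl R X Y -> Prop :=
| join_step0 (x0 : X) (y1 y2 : Y) (t : unit_itv R) :
    set_val t = 0 -> join_step (x0, y1, t) (x0, y2, t)
| join_step1 (x1 x2 : X) (y0 : Y) (t : unit_itv R) :
    set_val t = 1 -> join_step (x1, y0, t) (x2, y0, t).

Definition join_relb (R : realType) (X Y : topologicalType) :
    rel (join_cyl R X Y) :=
  fun p q => `[< clos_refl_sym_trans _ (@join_step R X Y) p q >].

Lemma join_relb_refl (R : realType) (X Y : topologicalType) :
  reflexive (@join_relb R X Y).
Proof. by move=> p; apply/asboolP; exact: rst_refl. Qed.

Lemma join_relb_sym (R : realType) (X Y : topologicalType) :
  symmetric (@join_relb R X Y).
Proof.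
by move=> p q; apply/idP/idP => /asboolP h; apply/asboolP; exact: rst_sym.
Qed.

Lemma join_relb_trans (R : realType) (X Y : topologicalType) :
  transitive (@join_relb R X Y).
Proof.
move=> q p r /asboolP pq /asboolP qr; apply/asboolP.
exact: rst_trans pq qr.
Qed.

Definition join_rel (R : realType) (X Y : topologicalType) :
    equiv_rel (join_cyl R X Y) :=
  EquivRel _ (@join_relb_refl R X Y) (@join_relb_sym R X Y)
    (@join_relb_trans R X Y).

(* The join is this quotient itself; in particular it is empty as soon as X or Y
   is, and the ends then contribute no points. *)
Definition join_space (R : realType) (X Y : topologicalType) : Type :=
  {eq_quot (join_rel R X Y)}.

HB.instance Definition _ (R : realType) (X Y : topologicalType) :=
  Topological.copy (join_space R X Y)
    (quotient_topology {eq_quot (join_rel R X Y)}).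
HB.instance Definition _ (R : realType) (X Y : topologicalType) :=
  Quotient.copy (join_space R X Y) {eq_quot (join_rel R X Y)}.

Definition join_pi (R : realType) (X Y : topologicalType) :
  join_cyl R X Y -> join_space R X Y := \pi_(join_space R X Y).

Definition join_end0 (R : realType) (X Y : topologicalType) (A : set X) :
    set (join_space R X Y) :=
  @join_pi R X Y @` [set p | A p.1.1 /\ set_val p.2 = 0].

Definition join_end1 (R : realType) (X Y : topologicalType) (B : set Y) :
    set (join_space R X Y) :=
  @join_pi R X Y @` [set p | B p.1.2 /\ set_val p.2 = 1].

Definition join_mid (R : realType) (X Y : topologicalType)
    (A : set X) (B : set Y) : set (join_space R X Y) :=
  @join_pi R X Y @` [set p | [/\ A p.1.1, B p.1.2 & 0 < set_val p.2 < 1]].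

Definition join_piece (R : realType) (X Y : topologicalType) (I J : Type)
    (A : I -> set X) (B : J -> set Y) (k : I + J + I * J) :
    set (join_space R X Y) :=
  match k with
  | inl (inl i) => join_end0 (A i)
  | inl (inr j) => join_end1 (B j)
  | inr (i, j) => join_mid (A i) (B j)
  end.

(* Main.v *)
Require Import Defs.
From mathcomp Require Import all_boot all_order all_algebra.
From mathcomp Require Import all_classical all_reals topology normedtype.
From mathcomp Require Import generic_quotient lra.
From Stdlib Require Import Relation_Operators.

(** The projection pi of the cylinder X * Y * [0,1] onto the join only forgets
    the Y-coordinate where t = 0 and the X-coordinate where t = 1
    (join_pi_coord). All five conditions are therefore checked on saturated
    subsets of the cylinder, that is, on unions of fibres of pi: for these,
    membership in the image is membership upstairs, and open or closed sets
    have open or closed images.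

    Given C in X and D in Y, let subjoin C D be the saturated set of points
    whose X-coordinate, unless forgotten, lies in C and whose Y-coordinate,
    unless forgotten, lies in D. It is the preimage of the join of C and D,
    read as the points of C at the end t = 0 when D is empty (and dually), and
    it is closed when C and D are (closed_subjoin). Each piece is the image of
    such a closed set cut by a saturated open set: an open condition on the
    X-coordinate together with t < 1, one on the Y-coordinate together with
    t > 0, or both. So the pieces are locally closed. The closure of a nonempty piece is the image of the
    subjoin of the closures of its factors (closure_join_piece): the closed
    set contains the piece, and every point of it is equivalent to a limit of
    the piece, because (0,1) is dense in [0,1]. The frontier condition, like
    disjointness and covering, then reduces to the one in each factor.

    Local finiteness holds because a compact space has only finitely many
    nonempty pieces (finite_pieces_compact), which leaves finitely many
    nonempty pieces of the join. *)

Set Implicit Arguments.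
Unset Strict Implicit.
Unset Printing Implicit Defensive.

Import Order.TTheory GRing.Theory Num.Theory.
Import numFieldNormedType.Exports.

Local Open Scope classical_set_scope.
Local Open Scope ring_scope.
Local Open Scope quotient_scope.

(** * Finiteness of decompositions of compact spaces *)

(** Compactness is used in its near-covering form, along the filter F by which
    a set of indices eventually contains any given finite set: near each point
    it eventually contains the indices of all pieces that pass there, hence so
    it does uniformly over the whole space, and a finite set is enough. *)
Lemma finite_pieces_compact (T : topologicalType) (I : Type) (S : I -> set T) :
  compact [set: T] -> locally_finite S -> finite_set [set i | S i !=set0].
Proof.
move=> /compact_near_coveringP ncT lfS.
pose F : set_system (set I) :=
  filter_from (@finite_set I) (fun D => [set E | D `<=` E]).
have FF : Filter F.
  apply: filter_from_filter; first by exists set0; exact: finite_set0.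
  move=> D E fD fE; exists (D `|` E); first by rewrite finite_setU.
  by move=> G sub; split=> i Gi; apply: sub; [left|right].
have [|D finD Dall] := ncT _ F (fun E x => forall i, S i x -> E i) FF.
  move=> x _; have [U Ux finU] := lfS x.
  exists (U, [set E | [set i | U `&` S i !=set0] `<=` E]).
    by split=> //; exists [set i | U `&` S i !=set0].
  by move=> [y E] /= [Uy sub] i Siy; apply: sub; exists y.
apply: sub_finite_set finD => i [x Six].
exact: (Dall D (@subset_refl _ D) x Logic.I i Six).
Qed.

(** * Saturated sets and the topology of the join *)

Section join.
Variables (R : realType) (X Y : topologicalType).
Local Notation cyl := (join_cyl R X Y).
Local Notation pi := (@join_pi R X Y).
Implicit Types (S W C : set cyl) (p q : cyl).

(** The three conditions are an equivalence relation that contains both kinds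
    of generators. *)
Lemma join_pi_coord p q : pi p = pi q ->
  [/\ p.2 = q.2, set_val p.2 <> 1 -> p.1.1 = q.1.1 &
                 set_val p.2 <> 0 -> p.1.2 = q.1.2].
Proof.
move=> /(eqmodP (join_rel R X Y)) /asboolP; elim => {p q}.
- by move=> p q [x0 y1 y2 t t0|x1 x2 y0 t t1]; split.
- by [].
- move=> p q _ [e ex ey]; split; rewrite -?e //.
  + by move=> /ex ->.
  + by move=> /ey ->.
- move=> p q r _ [e ex ey] _ [e' ex' ey']; split.
  + by rewrite e.
  + by move=> h; rewrite ex // ex' // -e.
  + by move=> h; rewrite ey // ey' // -e.
Qed.

Lemma join_pi_end0 (x : X) (y y' : Y) (t : unit_itv R) :
  set_val t = 0 -> pi (x, y, t) = pi (x, y', t).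
Proof.
by move=> t0; apply/(eqmodP (join_rel R X Y))/asboolP/rst_step/join_step0.
Qed.

Lemma join_pi_end1 (x x' : X) (y : Y) (t : unit_itv R) :
  set_val t = 1 -> pi (x, y, t) = pi (x', y, t).
Proof.
by move=> t1; apply/(eqmodP (join_rel R X Y))/asboolP/rst_step/join_step1.
Qed.

Lemma join_pi_surj (z : join_space R X Y) : exists p, pi p = z.
Proof. by exists (repr z); exact: reprK. Qed.

Definition saturated S := forall p q, pi p = pi q -> S p -> S q.

Lemma saturated_image S p : saturated S -> (pi @` S) (pi p) <-> S p.
Proof.
by move=> satS; split=> [[q Sq qp]|Sp]; [exact: satS Sq|exists p].
Qed.

Lemma saturated_preimage S : saturated S -> pi @^-1` (pi @` S) = S.
Proof. by move=> satS; apply/seteqP; split=> p /(saturated_image _ satS). Qed.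

Lemma open_join_pi W : open W -> saturated W -> open (pi @` W).
Proof. by move=> oW satW; rewrite /open /= /quotient_open saturated_preimage. Qed.

(** Saturation makes the image commute with complements. *)
Lemma closed_join_pi C : closed C -> saturated C -> closed (pi @` C).
Proof.
move=> cC satC; rewrite -openC.
have -> : ~` (pi @` C) = pi @` (~` C).
  apply/seteqP; split=> [z|_ [p nCp <-]]; last by move/(saturated_image _ satC).
  have [p <-] := join_pi_surj z => nCp; exists p => // Cp.
  by apply: nCp; exists p.
apply: open_join_pi; first by rewrite openC.
by move=> p q pq nCp Cq; apply: nCp; apply: satC Cq.
Qed.

Lemma locally_closed_join_pi W C : open W -> saturated W ->
  closed C -> saturated C -> locally_closed (pi @` (W `&` C)).
Proof.
move=> oW sW cC sC; exists (pi @` W), (pi @` C).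
split; [exact: open_join_pi|exact: closed_join_pi|].
apply/seteqP; split=> [_ [p [Wp Cp] <-]|z]; first by split; exists p.
by move=> [[p Wp <-] /(saturated_image _ sC) Cp]; exists p.
Qed.

(** The closure of S need not be saturated, so its image need not be closed; C
    plays the role of its saturation. *)
Lemma closure_join_pi S C : closed C -> saturated C -> S `<=` C ->
  C `<=` pi @^-1` (pi @` closure S) -> closure (pi @` S) = pi @` C.
Proof.
move=> cC satC SC CS; apply/seteqP; split.
  rewrite closureE; apply: smallest_sub; first exact: closed_join_pi.
  exact: image_subset.
move=> _ [p /CS [q clq <-] <-] V /pi_continuous /clq [r [Sr Vr]].
by exists (pi r); split=> //; exists r.
Qed.

(** * Subjoins and closures of the pieces *)

Lemma join_x_continuous : continuous (fun p : cyl => p.1.1).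
Proof. by move=> p; apply: (@continuous_comp _ _ _ fst fst); exact: cvg_fst. Qed.

Lemma join_y_continuous : continuous (fun p : cyl => p.1.2).
Proof.
by move=> p; apply: (@continuous_comp _ _ _ fst snd);
  [exact: cvg_fst|exact: cvg_snd].
Qed.

Lemma join_t_continuous : continuous (fun p : cyl => set_val p.2 : R).
Proof.
move=> p; apply: (@continuous_comp cyl (unit_itv R) R snd set_val).
  exact: cvg_snd.
exact: initial_continuous.
Qed.

(** The preimage of the join of C and D. With D empty it is C at the end t = 0,
    and with C empty it is D at the end t = 1. *)
Definition subjoin (C : set X) (D : set Y) : set cyl :=
  [set p | (set_val p.2 <> 1 -> C p.1.1) /\ (set_val p.2 <> 0 -> D p.1.2)].

Lemma saturated_subjoin (C : set X) (D : set Y) : saturated (subjoin C D).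
Proof.
move=> p q /join_pi_coord [e ex ey] [Cp Dp]; split; rewrite -e => h.
  by rewrite -ex //; exact: Cp.
by rewrite -ey //; exact: Dp.
Qed.

Lemma closed_subjoin (C : set X) (D : set Y) :
  closed C -> closed D -> closed (subjoin C D).
Proof.
move=> cC cD.
have -> : subjoin C D =
    ((fun p : cyl => set_val p.2 : R) @^-1` [set 1] `|`
     (fun p : cyl => p.1.1) @^-1` C) `&`
    ((fun p : cyl => set_val p.2 : R) @^-1` [set 0] `|`
     (fun p : cyl => p.1.2) @^-1` D).
  apply/seteqP; split=> p /=.
    move=> [Cp Dp]; split; rewrite /setU /=.
      by have [|/Cp] := pselect (set_val p.2 = 1 :> R); [left|right].
    by have [|/Dp] := pselect (set_val p.2 = 0 :> R); [left|right].
  by move=> [[h|h] [h'|h']]; split.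
apply: closedI; apply: closedU; apply: preimage_closed => //;
  try (by move=> p _; exact: join_t_continuous).
- by move=> p _; exact: join_x_continuous.
- by move=> p _; exact: join_y_continuous.
Qed.

Lemma unit_itv_bounds (t : unit_itv R) : 0 <= (set_val t : R) <= 1.
Proof. by have := set_valP t; rewrite /= in_itv. Qed.

Lemma closure_unit_itvoo (t : unit_itv R) :
  closure [set s : unit_itv R | 0 < (set_val s : R) < 1] t.
Proof.
move=> V [_ [[O oO <-] Ot] OV].
have [e /= e0 eO] := (nbhs_ballP (set_val t : R) O).1
  (open_nbhs_nbhs (conj oO Ot)).
have /andP[t0 t1] := unit_itv_bounds t.
have [s [s01 Os]] : exists s : R, 0 < s < 1 /\ O s.
  (* A step towards the middle of [0,1], of length d: at most 1/4 so as not to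
     overshoot the far end, and shorter than e so as to stay in O. *)
  pose d : R := Num.min (e / 2) (1 / 4).
  have d0 : 0 < d by rewrite lt_min; apply/andP; split; lra.
  have [de d4] : d <= e / 2 /\ d <= 1 / 4 by rewrite !ge_min !lexx orbT.
  have [t2|t2] := leP (set_val t : R) (1 / 2).
  - exists (set_val t + d); split; first by apply/andP; split; lra.
    by apply: eO; rewrite /ball /= opprD addNKr normrN gtr0_norm //; lra.
  - exists (set_val t - d); split; first by apply/andP; split; lra.
    by apply: eO; rewrite /ball /= opprB addrC subrK gtr0_norm //; lra.
have s01c : s \in (`[0, 1]%classic : set R).
  by rewrite inE /= in_itv /=; case/andP: s01 => /ltW -> /ltW ->.
exists (SigSub s01c : unit_itv R); split => //.
by apply: OV.
Qed.

Lemma closure_cyl (A : set X) (B : set Y) (T : set (unit_itv R)) p :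
  closure A p.1.1 -> closure B p.1.2 -> closure T p.2 ->
  closure [set q : cyl | [/\ A q.1.1, B q.1.2 & T q.2]] p.
Proof.
case: p => [[x y] t] /= clA clB clT V.
move=> [[P Q] /= [[[P1 P2] [P1x P2y] P12] Qt] PQ].
have [x' [Ax' Px']] := clA _ P1x.
have [y' [By' Py']] := clB _ P2y.
have [t' [Tt' Qt']] := clT _ Qt.
exists (x', y', t'); split=> //; apply: PQ; split => //.
exact: P12.
Qed.

Lemma closure_join_end0 (A : set X) :
  closure (join_end0 A) = pi @` subjoin (closure A) set0.
Proof.
apply: closure_join_pi.
- by apply: closed_subjoin; [exact: closed_closure|exact: closed0].
- exact: saturated_subjoin.
- by move=> p [Ap p0]; split=> // _; exact: subset_closure.
- move=> p [Ap p0]; exists p => //.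
  have {}p0 : set_val p.2 = 0 :> R by apply: contrapT.
  have -> : [set p : cyl | A p.1.1 /\ set_val p.2 = 0] =
    [set q : cyl | [/\ A q.1.1, setT q.1.2 & set_val q.2 = 0]].
    by apply/seteqP; split=> q [].
  apply: (closure_cyl (T := [set t | set_val t = 0])).
  + by apply: Ap; rewrite p0 => /esym/eqP; rewrite oner_eq0.
  + exact: subset_closure.
  + exact: subset_closure.
Qed.

Lemma closure_join_end1 (B : set Y) :
  closure (join_end1 B) = pi @` subjoin set0 (closure B).
Proof.
apply: closure_join_pi.
- by apply: closed_subjoin; [exact: closed0|exact: closed_closure].
- exact: saturated_subjoin.
- by move=> p [Bp p1]; split=> // _; exact: subset_closure.
- move=> p [p1 Bp]; exists p => //.
  have {}p1 : set_val p.2 = 1 :> R by apply: contrapT.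
  have -> : [set p : cyl | B p.1.2 /\ set_val p.2 = 1] =
    [set q : cyl | [/\ setT q.1.1, B q.1.2 & set_val q.2 = 1]].
    by apply/seteqP; split=> q [].
  apply: (closure_cyl (T := [set t | set_val t = 1])).
  + exact: subset_closure.
  + by apply: Bp; rewrite p1 => /eqP; rewrite oner_eq0.
  + exact: subset_closure.
Qed.

(** Both factors have to be nonempty: the end t = 0 of the closure is reached
    along a point of B, and the end t = 1 along a point of A. *)
Lemma closure_join_mid (A : set X) (B : set Y) : A !=set0 -> B !=set0 ->
  closure (join_mid A B) = pi @` subjoin (closure A) (closure B).
Proof.
move=> [a Aa] [b Bb]; apply: closure_join_pi.
- by apply: closed_subjoin; exact: closed_closure.
- exact: saturated_subjoin.
- by move=> p [Ap Bp _]; split=> _; exact: subset_closure.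
move=> [[x y] t] [/= clA clB].
pose T : set (unit_itv R) := [set s | 0 < (set_val s : R) < 1].
have [t0|tn0] := pselect (set_val t = 0 :> R).
  (* y is forgotten here and need not be a limit of B, but b is one. *)
  exists (x, b, t); last exact: join_pi_end0.
  apply: (closure_cyl (T := T)); [|exact: subset_closure|exact: closure_unit_itvoo].
  by apply: clA; rewrite t0 => /esym/eqP; rewrite oner_eq0.
have [t1|tn1] := pselect (set_val t = 1 :> R).
  exists (a, y, t); last exact: join_pi_end1.
  apply: (closure_cyl (T := T)); [exact: subset_closure| |exact: closure_unit_itvoo].
  exact: clB.
exists (x, y, t) => //.
by apply: (closure_cyl (T := T)); [exact: clA|exact: clB|exact: closure_unit_itvoo].
Qed.

(** * Local closedness of the pieces *)

(** Saturated because the X-coordinate is only forgotten at t = 1. *)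
Definition open_lower (O : set X) : set cyl :=
  [set p | O p.1.1 /\ set_val p.2 < (1 : R)].

Definition open_upper (O : set Y) : set cyl :=
  [set p | O p.1.2 /\ (0 : R) < set_val p.2].

Lemma open_open_lower (O : set X) : open O -> open (open_lower O).
Proof.
move=> oO; apply: openI.
  by apply: open_comp oO => p _; exact: join_x_continuous.
by apply: open_comp (@open_lt R _) => p _; exact: join_t_continuous.
Qed.

Lemma open_open_upper (O : set Y) : open O -> open (open_upper O).
Proof.
move=> oO; apply: openI.
  by apply: open_comp oO => p _; exact: join_y_continuous.
by apply: open_comp (@open_gt R _) => p _; exact: join_t_continuous.
Qed.

Lemma saturated_open_lower (O : set X) : saturated (open_lower O).
Proof.
move=> p q /join_pi_coord [e ex _] [Op p1]; split; rewrite -?e // -ex //.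
by move=> p1'; move: p1; rewrite p1' ltxx.
Qed.

Lemma saturated_open_upper (O : set Y) : saturated (open_upper O).
Proof.
move=> p q /join_pi_coord [e _ ey] [Op p0]; split; rewrite -?e // -ey //.
by move=> p0'; move: p0; rewrite p0' ltxx.
Qed.

Lemma locally_closed_join_end0 (A : set X) :
  locally_closed A -> locally_closed (@join_end0 R X Y A).
Proof.
move=> [O [C [oO cC ->]]].
have -> : join_end0 (O `&` C) = pi @` (open_lower O `&` subjoin C set0).
  rewrite /join_end0; congr (_ @` _); apply/seteqP; split=> p.
    by move=> [[Op Cp] p0]; split; split=> //; rewrite p0 ltr01.
  move=> [[Op p1] [Cp p0]]; split; last exact: contrapT.
  by split=> //; apply: Cp => p1'; move: p1; rewrite p1' ltxx.
apply: locally_closed_join_pi; [exact: open_open_lower|exact: saturated_open_lower|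
  |exact: saturated_subjoin].
by apply: closed_subjoin => //; exact: closed0.
Qed.

Lemma locally_closed_join_end1 (B : set Y) :
  locally_closed B -> locally_closed (@join_end1 R X Y B).
Proof.
move=> [O [C [oO cC ->]]].
have -> : join_end1 (O `&` C) = pi @` (open_upper O `&` subjoin set0 C).
  rewrite /join_end1; congr (_ @` _); apply/seteqP; split=> p.
    by move=> [[Op Cp] p1]; split; split=> //; rewrite p1 ltr01.
  move=> [[Op p0] [p1 Cp]]; split; last exact: contrapT.
  by split=> //; apply: Cp => p0'; move: p0; rewrite p0' ltxx.
apply: locally_closed_join_pi; [exact: open_open_upper|exact: saturated_open_upper|
  |exact: saturated_subjoin].
by apply: closed_subjoin => //; exact: closed0.
Qed.

Lemma locally_closed_join_mid (A : set X) (B : set Y) :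
  locally_closed A -> locally_closed B -> locally_closed (@join_mid R X Y A B).
Proof.
move=> [O [C [oO cC ->]]] [P [D [oP cD ->]]].
have -> : join_mid (O `&` C) (P `&` D) =
    pi @` (open_lower O `&` open_upper P `&` subjoin C D).
  rewrite /join_mid; congr (_ @` _); apply/seteqP; split=> p.
    by move=> [[Op Cp] [Pp Dp] /andP[p0 p1]].
  move=> [[[Op p1] [Pp p0]] [Cp Dp]].
  split; last by apply/andP.
    by split=> //; apply: Cp => p1'; move: p1; rewrite p1' ltxx.
  by split=> //; apply: Dp => p0'; move: p0; rewrite p0' ltxx.
apply: locally_closed_join_pi; [| |exact: closed_subjoin|exact: saturated_subjoin].
  by apply: openI; [exact: open_open_lower|exact: open_open_upper].
move=> p q pq [Op Pp]; split; [exact: saturated_open_lower Op|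
  exact: saturated_open_upper Pp].
Qed.

(** * The pieces in coordinates *)

Section pieces.
Variables (I J : Type) (A : I -> set X) (B : J -> set Y).

Local Notation piece := (@join_piece R X Y I J A B).

Definition cyl_piece (k : I + J + I * J) : set cyl :=
  match k with
  | inl (inl i) => [set p | A i p.1.1 /\ set_val p.2 = 0]
  | inl (inr j) => [set p | B j p.1.2 /\ set_val p.2 = 1]
  | inr (i, j) => [set p | [/\ A i p.1.1, B j p.1.2 & 0 < set_val p.2 < 1]]
  end.

(** The preimage of the closure of a piece, for the nonempty pieces only: an
    empty middle piece can have one empty factor while the other contributes
    an end here. *)
Definition cyl_closure (k : I + J + I * J) : set cyl :=
  match k with
  | inl (inl i) => subjoin (closure (A i)) set0
  | inl (inr j) => subjoin set0 (closure (B j))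
  | inr (i, j) => subjoin (closure (A i)) (closure (B j))
  end.

Lemma join_pieceE k : piece k = pi @` cyl_piece k.
Proof. by case: k => [[i|j]|[i j]]. Qed.

Lemma saturated_cyl_piece k : saturated (cyl_piece k).
Proof.
have n01 : (0 : R) <> 1 by move=> /esym/eqP; rewrite oner_eq0.
case: k => [[i|j]|[i j]] p q /join_pi_coord [e ex ey] /=; rewrite -e.
- by move=> [Ap p0]; split=> //; rewrite -ex // p0.
- by move=> [Bp p1]; split=> //; rewrite -ey // p1; exact: nesym.
- move=> [Ap Bp /andP[p0 p1]]; split; last by rewrite p0.
    by rewrite -ex // => h; move: p1; rewrite h ltxx.
  by rewrite -ey // => h; move: p0; rewrite h ltxx.
Qed.

Lemma closure_join_piece k : piece k !=set0 ->
  closure (piece k) = pi @` cyl_closure k.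
Proof.
case: k => [[i|j]|[i j]] /=; [by rewrite closure_join_end0|
  by rewrite closure_join_end1|].
move=> [_ [p [Ap Bp _] _]]; rewrite closure_join_mid //.
  by exists p.1.1.
by exists p.1.2.
Qed.

(** A coordinate of p that is not forgotten witnesses that a piece of the
    corresponding factor meets the closure of another one; the forgotten
    coordinate imposes nothing on either side. *)
Lemma cyl_piece_frontier :
  (forall i i', A i `&` closure (A i') !=set0 -> A i `<=` closure (A i')) ->
  (forall j j', B j `&` closure (B j') !=set0 -> B j `<=` closure (B j')) ->
  forall k l p, cyl_piece k p -> cyl_closure l p ->
    cyl_piece k `<=` cyl_closure l.
Proof.
move=> frA frB k l p.
have n01 : (0 : R) <> 1 by move=> /esym/eqP; rewrite oner_eq0.
have mid (t : R) : 0 < t < 1 -> t <> 0 /\ t <> 1.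
  by move=> /andP[t0 t1]; split=> h; move: t0 t1; rewrite h ltxx.
case: k => [[i|j]|[i j]] /=.
- move=> [Ap p0]; case: l => [[i'|j']|[i' j']] [clA _] q [Aq q0]; split;
    rewrite q0 // => _; rewrite p0 in clA; have := clA n01 => //;
    by move=> clAp; apply: (frA i) => //; exists p.1.1.
- move=> [Bp p1]; case: l => [[i'|j']|[i' j']] [_ clB] q [Bq q1]; split;
    rewrite q1 // => _; rewrite p1 in clB; have := clB (nesym n01) => //;
    by move=> clBp; apply: (frB j) => //; exists p.1.2.
- move=> [Ap Bp /mid[p0 p1]]; case: l => [[i'|j']|[i' j']] [clA clB] q [Aq Bq _].
  + by have := clB p0.
  + by have := clA p1.
  + split=> _.
      by apply: (frA i) => //; exists p.1.1; split=> //; exact: clA.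
    by apply: (frB j) => //; exists p.1.2; split=> //; exact: clB.
Qed.

Lemma cyl_piece_disjoint : trivIset setT A -> trivIset setT B ->
  trivIset setT cyl_piece.
Proof.
move=> tA tB k l _ _ [p []].
have n01 : (0 : R) <> 1 by move=> /esym/eqP; rewrite oner_eq0.
have eqA i i' : A i p.1.1 -> A i' p.1.1 -> i = i'.
  by move=> h h'; apply: tA => //; exists p.1.1.
have eqB j j' : B j p.1.2 -> B j' p.1.2 -> j = j'.
  by move=> h h'; apply: tB => //; exists p.1.2.
case: k => [[i|j]|[i j]]; case: l => [[i'|j']|[i' j']] /=.
- by move=> [Ai _] [Ai' _]; rewrite (eqA i i').
- by move=> [_ ->] [_ /n01].
- by move=> [_ ->] [_ _]; rewrite ltxx.
- by move=> [_ ->] [_ /esym/n01].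
- by move=> [Bj _] [Bj' _]; rewrite (eqB j j').
- by move=> [_ ->] [_ _]; rewrite ltxx andbF.
- by move=> [_ _ h] [_ p0]; move: h; rewrite p0 ltxx.
- by move=> [_ _ h] [_ p1]; move: h; rewrite p1 ltxx andbF.
- by move=> [Ai Bj _] [Ai' Bj' _]; rewrite (eqA i i') // (eqB j j').
Qed.

Lemma cyl_piece_cover : \bigcup_i A i = setT -> \bigcup_j B j = setT ->
  \bigcup_k cyl_piece k = setT.
Proof.
move=> cA cB; apply/seteqP; split=> // p _.
have [i _ Ai] : (\bigcup_i A i) p.1.1 by rewrite cA.
have [j _ Bj] : (\bigcup_j B j) p.1.2 by rewrite cB.
have := unit_itv_bounds p.2.
rewrite !le_eqVlt => /andP[/orP[/eqP t0|t0] /orP[/eqP t1|t1]].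
- by exists (inl (inl i)).
- by exists (inl (inl i)).
- by exists (inl (inr j)).
- by exists (inr (i, j)) => //; split=> //; rewrite t0.
Qed.

Lemma finite_join_piece : finite_set [set i | A i !=set0] ->
  finite_set [set j | B j !=set0] ->
  finite_set [set k | piece k !=set0].
Proof.
move=> finA finB.
apply: (@sub_finite_set _ _ ((inl \o inl) @` [set i | A i !=set0] `|`
  (inl \o inr) @` [set j | B j !=set0] `|`
  inr @` ([set i | A i !=set0] `*` [set j | B j !=set0]))).
  move=> [[i|j]|[i j]].
  - by move=> [_ [p [Ap _] _]]; left; left; exists i => //; exists p.1.1.
  - by move=> [_ [p [Bp _] _]]; left; right; exists j => //; exists p.1.2.
  - move=> [_ [p [Ap Bp _] _]]; right; exists (i, j) => //.
    by split; [exists p.1.1|exists p.1.2].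
rewrite !finite_setU; split; [split|]; apply: finite_image => //.
exact: finite_setX.
Qed.

End pieces.
End join.

Theorem proposition11 (R : realType) (X Y : topologicalType) (I J : Type)
    (A : I -> set X) (B : J -> set Y) :
  hausdorff_space X -> compact [set: X] ->
  hausdorff_space Y -> compact [set: Y] ->
  decomposition A -> decomposition B ->
  decomposition (@join_piece R X Y I J A B).
Proof.
move=> _ cX _ cY [lfA dA lcA cA frA] [lfB dB lcB cB frB]; split.
- move=> z; exists setT; first exact: filterT.
  apply: sub_finite_set (finite_join_piece R (finite_pieces_compact cX lfA)
    (finite_pieces_compact cY lfB)) => k [w [_ kw]].
  by exists w.
- move=> k l _ _ [z []]; have [p <-] := join_pi_surj z.
  rewrite !join_pieceE.
  move=> /(saturated_image _ (@saturated_cyl_piece _ _ _ _ _ A B k)) kp.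
  move=> /(saturated_image _ (@saturated_cyl_piece _ _ _ _ _ A B l)) lp.
  by apply: (cyl_piece_disjoint dA dB) => //; exists p.
- case=> [[i|j]|[i j]]; [exact: locally_closed_join_end0|
    exact: locally_closed_join_end1|exact: locally_closed_join_mid].
- apply/seteqP; split=> // z _; have [p <-] := join_pi_surj z.
  have [k _ kp] : (\bigcup_k cyl_piece A B k) p by rewrite cyl_piece_cover.
  by exists k => //; rewrite join_pieceE; exists p.
- move=> k l [z [kz lz]].
  have nel : @join_piece R X Y I J A B l !=set0.
    by have [w [lw _]] := lz setT filterT; exists w.
  move: kz lz; rewrite closure_join_piece // join_pieceE => -[p kp <-] [q lq qp].
  have lp : cyl_closure A B l p.
    by case: l {nel} lq => [[i|j]|[i j]]; exact: saturated_subjoin.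
  exact/image_subset/(cyl_piece_frontier frA frB kp lp).
Qed.
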